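(* Let $X$ be a continuous random variable with values in $[-1,1]$ and probability density function $f_X$ on $[-1,1]$, where $f_X$ is continuous on $[-1,1]$ and is expanded in a Chebyshev series that converges absolutely, $$f_X(x)=\sum_{l=0}^\infty \mu_l T_l(x),\qquad x\in[-1,1],$$ with real coefficients $\mu_l$. Then, as $k\to\infty$, the random variables $T_k(X)$ converge in distribution to a random variable $\Gamma$ on $(-1,1)$ with probability density function $$f_\Gamma(z)=\frac{1}{\pi}\,\frac{1}{\sqrt{1-z^2}},\qquad z\in(-1,1).$$
   Context: For an integer $k\ge 0$, $T_k$ denotes the $k$-th Chebyshev polynomial of the first kind, given on $[-1,1]$ by $T_k(x)=\cos(k\cos^{-1}(x))$, where $\cos^{-1}=\arccos:[-1,1]\to[0,\pi]$. *)

(* Defs.v *)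
From HB Require Import structures.
From mathcomp Require Import all_boot all_order all_algebra.
From mathcomp Require Import all_classical all_reals all_analysis.
From mathcomp Require Import ring measurable_realfun.

Set Implicit Arguments.
Unset Strict Implicit.
Unset Printing Implicit Defensive.

Import Order.TTheory GRing.Theory Num.Theory.
Import numFieldNormedType.Exports.

Local Open Scope classical_set_scope.
Local Open Scope ring_scope.

Fixpoint chebyshev_poly (R : realType) (k : nat) : {poly R} :=
  match k with
  | 0%N => 1
  | k'.+1 => match k' with
             | 0%N => 'X
             | k''.+1 => 2%:P * 'X * chebyshev_poly R k' - chebyshev_poly R k''
             end
  end.

Definition chebyshevT (R : realType) (k : nat) : R -> R :=
  fun x => (chebyshev_poly R k).[x].

Lemma chebyshevTSS (R : realType) (k : nat) (x : R) :
  chebyshevT k.+2 x = 2 * x * chebyshevT k.+1 x - chebyshevT k x.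
Proof. by rewrite /chebyshevT [chebyshev_poly R k.+2]/= !hornerE. Qed.

Lemma chebyshevT_cos (R : realType) (k : nat) (t : R) :
  chebyshevT k (cos t) = cos (k%:R * t).
Proof.
suff: chebyshevT k (cos t) = cos (k%:R * t) /\
      chebyshevT k.+1 (cos t) = cos (k.+1%:R * t) by case.
elim: k => [|k [IH0 IH1]].
  by rewrite mul0r mul1r cos0 /chebyshevT /= !hornerE.
split=> //; rewrite chebyshevTSS IH1 IH0.
have -> : k.+2%:R * t = k.+1%:R * t + t by rewrite -[k.+2%:R]natr1 mulrDl mul1r.
have -> : k%:R * t = k.+1%:R * t - t by rewrite -[k.+1%:R]natr1 mulrDl mul1r addrK.
rewrite cosB cosD; ring.
Qed.

(* The trigonometric definition of T_k on [-1, 1]. *)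
Lemma chebyshevT_acos (R : realType) (k : nat) (x : R) :
  x \in `[-1, 1] -> chebyshevT k x = cos (k%:R * acos x).
Proof. by move=> xI; rewrite -chebyshevT_cos acosK. Qed.

Lemma measurable_chebyshevT (R : realType) (k : nat) :
  measurable_fun [set: R] (@chebyshevT R k).
Proof. by apply: continuous_measurable_fun; exact: continuous_horner. Qed.

(* With this instance, [chebyshevT k \o X] is a random variable if X is. *)
HB.instance Definition _ (R : realType) (k : nat) :=
  isMeasurableFun.Build _ _ _ _ (@chebyshevT R k) (@measurable_chebyshevT R k).

(* f, considered only on D, is a probability density function of X with
   respect to the Lebesgue measure; all the mass of X lies in D. *)
Definition has_pdf_on (d : measure_display) (T : measurableType d)
    (R : realType) (P : probability T R) (X : {RV P >-> R})
    (D : set R) (f : R -> R) : Prop :=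
  [/\ measurable_fun D f,
      (forall x, D x -> 0 <= f x) &
      forall A : set R, measurable A ->
        distribution P X A = (\int[lebesgue_measure]_(x in A `&` D) (f x)%:E)%E].

(* The limit may live on a different probability space. *)
Definition cvg_in_distribution (R : realType)
    (d : measure_display) (T : measurableType d) (P : probability T R)
    (d' : measure_display) (T' : measurableType d') (P' : probability T' R)
    (Xn : nat -> {RV P >-> R}) (Y : {RV P' >-> R}) : Prop :=
  forall x : R, {for x, continuous (cdf Y)} ->
    cdf (Xn n) x @[n --> \oo] --> cdf Y x.

(* Main.v *)
(* With theta = arccos y, the set {T_k <= cos alpha} is, on each of the k arcs
   [j pi / k, (j + 1) pi / k[ of [0, pi], an interval of length
   (pi - alpha) / k.  In the variable theta, X has the continuous density
   g theta = f_X (cos theta) sin theta, so by the mean value theorem the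
   masses of that interval and of the whole arc are g xi (pi - alpha) / k and
   g eta pi / k, with xi and eta in the arc.  Uniform continuity of g shows
   that {T_k <= cos alpha} carries asymptotically the fraction
   (pi - alpha) / pi of the mass, which is the distribution function of the
   arcsine law at cos alpha. *)
Require Import Defs.
From HB Require Import structures.
From mathcomp Require Import all_boot all_order all_algebra.
From mathcomp Require Import all_classical all_reals all_analysis.
From mathcomp Require Import ring lra measurable_realfun.

Set Implicit Arguments.
Unset Strict Implicit.
Unset Printing Implicit Defensive.

Import Order.TTheory GRing.Theory Num.Theory.
Import numFieldNormedType.Exports.

Local Open Scope classical_set_scope.
Local Open Scope ring_scope.

(** * The arcsine law and its distribution function *)

Section arcsine.
Context {R : realType}.
Notation mu := lebesgue_measure.

Definition arcsine_pdf (z : R) : R := pi^-1 * (Num.sqrt (1 - z ^+ 2))^-1.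

Lemma arcsine_pdf_ge0 z : 0 <= arcsine_pdf z.
Proof. by rewrite mulr_ge0// invr_ge0 ?sqrtr_ge0 ?pi_ge0. Qed.

Lemma continuous_arcsine_pdf z : -1 < z < 1 -> {for z, continuous arcsine_pdf}.
Proof.
move=> /andP[z1 z2]; apply: cvgM; first exact: cvg_cst.
apply: cvgV.
  rewrite sqrtr_eq0 -ltNge; nra.
apply: (@continuous_comp _ _ _ (fun y : R => 1 - y ^+ 2) Num.sqrt);
  last exact: sqrt_continuous.
apply: cvgB; first exact: cvg_cst.
exact: exprn_continuous.
Qed.

Lemma measurable_arcsine_pdf : measurable_fun (`]-1, 1[ : set R) arcsine_pdf.
Proof.
apply: open_continuous_measurable_fun; first exact: interval_open.
move=> z; rewrite inE/= in_itv/=; exact: continuous_arcsine_pdf.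
Qed.

(** The limit law is put on the real line itself, so that [Gamma] can be essentially the identity
    map. *)
Definition arcsine_prob (A : set (measurableTypeR R)) : \bar R :=
  (\int[mu]_(z in A `&` `](-1)%R, 1%R[) (arcsine_pdf z)%:E)%E.

Let arcsine0 : arcsine_prob set0 = 0%E.
Proof. by rewrite /arcsine_prob set0I integral_set0. Qed.

Let arcsine_ge0 A : (0 <= arcsine_prob A)%E.
Proof. by apply: integral_ge0 => x _; rewrite lee_fin arcsine_pdf_ge0. Qed.

Let arcsine_sigma_additive : semi_sigma_additive arcsine_prob.
Proof.
move=> /= F mF tF mUF; rewrite /arcsine_prob; apply: cvg_toP.
  apply: ereal_nondecreasing_is_cvgn => m n mn.
  by apply: lee_sum_nneg_natr => // k _ _; exact: arcsine_ge0.
rewrite setI_bigcupl ge0_integral_bigcup//=.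
- by move=> k; apply: measurableI => //.
- apply/measurable_EFinP.
  apply: (measurable_funS _ _ measurable_arcsine_pdf) => //.
  by move=> x [k _ []].
- by move=> x _; rewrite lee_fin arcsine_pdf_ge0.
- by apply: trivIset_setIr.
Qed.

HB.instance Definition _ := isMeasure.Build _ _ _ arcsine_prob
  arcsine0 arcsine_ge0 arcsine_sigma_additive.

(** The density has the antiderivative [- acos / pi]. The endpoints stay strictly inside []-1, 1[],
    where the density is continuous and the fundamental theorem of calculus applies. *)
Let arcsine_prob_cc (u v : R) : -1 < u -> u < v -> v < 1 ->
  arcsine_prob `[u, v] = ((acos u - acos v) / pi)%:E.
Proof.
move=> u1 uv v1.
have uvI z : z \in `[u, v] -> -1 < z < 1.
  rewrite in_itv/= => /andP[uz zv].
  by rewrite (lt_le_trans u1)//= (le_lt_trans zv).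
rewrite /arcsine_prob setIidl; last by move=> z /= /uvI; rewrite in_itv/=.
pose F : R -> R := (- pi^-1 : R) \*: @acos R.
have Fd z : z \in `[u, v] ->
    is_derive z 1 F (arcsine_pdf z).
  move=> /uvI zI; have := is_derive1_acos zI => h.
  rewrite /arcsine_pdf.
  have := is_deriveZ (- pi^-1 : R) h.
  by rewrite /GRing.scale/= mulrNN.
have Fc z : z \in `[u, v] -> {for z, continuous F}.
  move=> /Fd h; apply: differentiable_continuous.
  by apply/derivable1_diffP; case: h.
have cF : {within `[u, v], continuous F}.
  by apply: continuous_in_subspaceT => z; rewrite inE/=; exact: Fc.
have cf : {within `[u, v], continuous arcsine_pdf}.
  apply: continuous_in_subspaceT => z; rewrite inE/= => /uvI.
  exact: continuous_arcsine_pdf.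
have sub z : z \in `]u, v[ -> z \in `[u, v] by apply: subset_itv_oo_cc.
rewrite (@continuous_FTC2 _ arcsine_pdf F)//.
- by rewrite -EFinB /F/= !scaleNr opprK addrC -scalerBr mulrC.
- have [c1 c2 c3] := (continuous_within_itvP _ uv).1 cF.
  by split; [move=> z /sub /Fd []|exact: c2|exact: c3].
- by move=> z /sub /Fd h; rewrite derive1E; apply: derive_val.
Qed.

(** Here [cos a] or [cos b] may be 1 or -1, where the density blows up. The open interval is
    therefore exhausted by closed intervals [E n] inside it, and the measure is continuous from
    below. *)
Lemma arcsine_prob_cos (a b : R) : 0 <= a -> a < b -> b <= pi ->
  arcsine_prob `]cos b, cos a[ = ((b - a) / pi)%:E.
Proof.
move=> a0 ab bpi.
(* The shift by 3 gives [3 * e n <= b - a], so [a + e n < b - e n] already for [n = 0]. *)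
pose e (n : nat) := (b - a) / n.+3%:R.
have e0 n : 0 < e n by rewrite divr_gt0 ?subr_gt0.
have e2 n : e n * 3 <= b - a.
  by rewrite /e mulrAC ler_pdivrMr// ler_pM2l ?subr_gt0// ler_nat.
have e_ni m n : (m <= n)%N -> e n <= e m.
  move=> mn; rewrite /e ler_pM2l ?subr_gt0// lef_pV2 ?posrE// ler_nat.
  by rewrite !ltnS.
have cvge : e n @[n --> \oo] --> (0 : R).
  rewrite -[X in _ --> X](mulr0 (b - a)); apply: cvgM; first exact: cvg_cst.
  have := @cvg_harmonic R; rewrite -(cvg_shiftn 2)/=.
  by under eq_fun do rewrite addn2.
have inI x : a <= x <= b -> x \in `[0, pi].
  by move=> /andP[ax xb]; rewrite in_itv/= (le_trans a0)//= (le_trans xb).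
have aI : a \in `[0, pi] by rewrite inI// lexx ltW.
have bI : b \in `[0, pi] by rewrite inI// lexx ltW.
pose E n := `[cos (b - e n), cos (a + e n)]%classic.
have EU : \bigcup_n E n = `]cos b, cos a[%classic.
  apply/seteqP; split => [y [n _]|y]/=.
    rewrite /E /= !in_itv/= => /andP[y1 y2].
    have := e0 n; have := e2 n => h2 h0.
    apply/andP; split.
      apply: lt_le_trans y1; rewrite ltr_cos ?inI//; lra.
    apply: le_lt_trans y2 _; rewrite ltr_cos ?inI//; lra.
  rewrite in_itv/= => /andP[y1 y2].
  have yI : -1 <= y <= 1.
    by rewrite (le_trans (cos_geN1 b) (ltW y1)) (le_trans (ltW y2) (cos_le1 a)).
  have yI' : acos y \in `[0, pi] by rewrite in_itv/= acos_ge0// acos_lepi.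
  have ya : a < acos y by rewrite -ltr_cos// acosK ?in_itv.
  have yb : acos y < b by rewrite -ltr_cos// acosK ?in_itv.
  (* Once [e n] is below both gaps, [acos y] lies between [a + e n] and [b - e n], that is, [y] is
     in [E n]. *)
  have : \forall n \near \oo, e n < Num.min (acos y - a) (b - acos y).
    apply: (cvgr_lt 0 cvge); by rewrite lt_min !subr_gt0 ya yb.
  case=> N _ /(_ N (leqnn N)) /=; rewrite lt_min => /andP[h1 h2].
  have := e0 N; have := e2 N => k2 k0.
  exists N => //; rewrite /E/= in_itv/= -[y]acosK ?in_itv//.
  rewrite !leNgt !ltr_cos ?inI//; try lra.
have : arcsine_prob (E n) @[n --> \oo] --> arcsine_prob (\bigcup_n E n).
  apply: nondecreasing_cvg_mu => //.
  - by move=> i; exact: measurable_itv.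
  - by rewrite EU; exact: measurable_itv.
  - move=> m n mn; rewrite subsetEset; apply: subset_itv; rewrite bnd_simp.
    + have := e_ni _ _ mn; have := e0 n; have := e2 m => h2 h0 hm.
      rewrite leNgt ltr_cos ?inI//; try lra.
    + have := e_ni _ _ mn; have := e0 n; have := e2 m => h2 h0 hm.
      rewrite leNgt ltr_cos ?inI//; try lra.
rewrite EU => /cvg_lim <- //; apply/cvg_lim => //.
have -> : (fun n => arcsine_prob (E n)) =
    (fun n => ((b - a - e n *+ 2) / pi)%:E).
  apply/funext => n; rewrite /E.
  have := e0 n; have := e2 n => h2 h0.
  have i1 : b - e n \in `[0, pi] by apply: inI; lra.
  have i2 : a + e n \in `[0, pi] by apply: inI; lra.
  rewrite arcsine_prob_cc.
  - rewrite !cosK//.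
    by congr EFin; congr (_ / _); ring.
  - rewrite -cospi ltr_cos ?i1 ?in_itv/= ?pi_ge0 ?lexx//; lra.
  - rewrite ltr_cos//; lra.
  - rewrite -cos0 ltr_cos ?i2 ?in_itv/= ?pi_ge0 ?lexx//; lra.
apply: cvg_EFin; first by near=> n.
rewrite -(subr0 (b - a)).
apply: cvgM; last exact: cvg_cst.
apply: cvgB; first by rewrite subr0; exact: cvg_cst.
by rewrite -[X in _ --> X](mul0rn _ 2); apply: cvgMn.
Unshelve. all: by end_near. Qed.

Lemma arcsine_prob_setI (A : set R) :
  arcsine_prob A = arcsine_prob (A `&` `]-1, 1[).
Proof. by rewrite /arcsine_prob -setIA setIid. Qed.

Let arcsine_prob_setT : arcsine_prob setT = 1%E.
Proof.
rewrite arcsine_prob_setI setTI -cospi -[X in `]_, X[]cos0.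
by rewrite arcsine_prob_cos ?pi_gt0// subr0 divff// gt_eqF ?pi_gt0.
Qed.

HB.instance Definition _ :=
  @Measure_isProbability.Build _ _ R arcsine_prob arcsine_prob_setT.

Lemma arcsine_prob_ray (x : R) : -1 <= x <= 1 ->
  arcsine_prob `]-oo, x] = ((pi - acos x) / pi)%:E.
Proof.
move=> /andP[x1 x2]; rewrite arcsine_prob_setI.
(* For [x = -1] the angle interval [[acos x, pi]] is degenerate, which [arcsine_prob_cos] excludes;
   the ray then misses []-1, 1[]. *)
have [->|xN1] := eqVneq x (-1).
  rewrite (_ : _ `&` _ = set0) ?measure0 ?acosN1 ?subrr ?mul0r//.
  apply/seteqP; split => // y []/=; rewrite !in_itv/= => y1 /andP[y2 _].
  by have := lt_le_trans y2 y1; rewrite ltxx.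
have {xN1} x1' : -1 < x by rewrite lt_neqAle eq_sym xN1.
(* The two sets differ at most by the point [x], a Lebesgue null set. *)
have -> : arcsine_prob (`]-oo, x] `&` `]-1, 1[ : set R) = arcsine_prob `]-1, x[.
  rewrite /arcsine_prob -setIA setIid.
  have [->|xne1] := eqVneq x 1.
    rewrite setIid; congr (integral _ _ _).
    apply/seteqP; split => y /=; rewrite !in_itv/=; first by case.
    by move=> /andP[-> y1]; rewrite y1 ltW.
  have x2' : x < 1 by rewrite lt_neqAle xne1.
  have -> : (`]-oo, x] `&` `]-1, 1[ : set R) = (`]-1, x]%classic : set R).
    apply/seteqP; split => y /=; rewrite !in_itv/=.
      by move=> [-> /andP[->]].
    by move=> /andP[-> yx]; rewrite yx (le_lt_trans yx).
  have -> : (`]-1, x[ `&` `]-1, 1[ : set R) = (`]-1, x[%classic : set R).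
    apply/seteqP; split => y /=; rewrite !in_itv/=; first by case.
    by move=> /andP[-> yx]; rewrite yx (lt_trans yx).
  rewrite -integral_itv_bndo_bndc//; apply/measurable_EFinP.
  apply: (measurable_funS _ _ measurable_arcsine_pdf) => //.
  by move=> y /=; rewrite !in_itv/= => /andP[-> /lt_trans ->].
rewrite -[in LHS]cospi -{1}[x]acosK ?in_itv/= ?x1//.
by rewrite arcsine_prob_cos ?acos_ge0 ?x1// acos_ltpi ?x1'.
Qed.

(* Truncating the identity changes it only on a null set and makes every value,
   not just almost every one, lie in ]-1, 1[. *)
Definition arcsine_var : measurableTypeR R -> R :=
  (id : R -> R) \_ (`]-1, 1[ : set R).

Lemma measurable_arcsine_var : measurable_fun setT arcsine_var.
Proof.
apply/measurable_restrict; [exact: measurable_itv|by []|].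
exact: measurable_id.
Qed.

HB.instance Definition _ := isMeasurableFun.Build _ _ _ _
  arcsine_var measurable_arcsine_var.

Lemma arcsine_var_itv (w : measurableTypeR R) : arcsine_var w \in `]-1, 1[.
Proof.
rewrite /arcsine_var patchE; case: ifPn; first by rewrite inE.
by rewrite in_itv/= ltrN10 ltr01.
Qed.

Lemma distribution_arcsine_var (A : set R) :
  distribution arcsine_prob (arcsine_var : {RV arcsine_prob >-> R}) A =
  arcsine_prob A.
Proof.
rewrite -[LHS]/(arcsine_prob (arcsine_var @^-1` A)).
rewrite [LHS]arcsine_prob_setI [RHS]arcsine_prob_setI.
congr arcsine_prob; apply/seteqP; split => w /= [h wI]; split => //; move: h.
  by rewrite /arcsine_var patchE mem_set.
by rewrite /arcsine_var patchE mem_set.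
Qed.

End arcsine.

(** * Uniform continuity, and a mean value theorem in the variable arccos y *)

Section mean_value_arccos.
Context {R : realType}.
Notation mu := lebesgue_measure.
Implicit Types f g : R -> R.

(** Heine's theorem. Compactness is used in its near-covering form: a radius that works locally
    around each [s], for all small [d > 0], works for all [s] in the segment at once. *)
Lemma continuous_segment_uniform g (a b e : R) : continuous g -> 0 < e ->
  exists2 d, 0 < d & {in `[a, b], forall s t, `|s - t| < d -> `|g s - g t| < e}.
Proof.
move=> cg e0.
have /compact_near_coveringP := @segment_compact _ a b.
move=> /(_ _ (0%R : R)^'+
  (fun d s => forall t, `|s - t| < d -> `|g s - g t| < e)).
case.
  move=> s _.
  have /cvgrPdist_lt/(_ (e / 2)) := cg s; rewrite divr_gt0// => /(_ isT).
  move=> /nbhs_ballP[r /= r0 sr].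
  (* With half the radius, both [s'] and any [t] within [d] of [s'] lie within [r] of the centre
     [s]. *)
  exists (ball s (r / 2), [set d | d < r / 2]).
    split; first by apply: nbhsx_ballx; rewrite divr_gt0.
    by apply: nbhs_right_lt; rewrite divr_gt0.
  move=> [s' d]/= [+ dr] t s't; rewrite /ball/= => ss'.
  have h1 : `|g s - g s'| < e / 2.
    apply: sr; rewrite /ball/= (lt_trans ss')//.
    by rewrite ltr_pdivrMr// ltr_pMr// ltr1n.
  have h2 : `|g s - g t| < e / 2.
    apply: sr; rewrite /ball/= -(subrKA s') (le_lt_trans (ler_normD _ _))//.
    by rewrite [r]splitr ltrD// (lt_trans s't).
  rewrite -(subrKA (g s)) (le_lt_trans (ler_normD _ _))//.
  by rewrite [e]splitr ltrD// distrC.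
move=> d /= d0 h; exists (d / 2); first by rewrite divr_gt0.
move=> s sab t st; apply: (h (d / 2)) => //=.
- rewrite /ball/= sub0r normrN gtr0_norm ?divr_gt0//.
  by rewrite ltr_pdivrMr// ltr_pMr// ltr1n.
- by rewrite divr_gt0.
Qed.

(** Since [cos] takes all its values in [[-1, 1]], continuity within that segment becomes continuity
    on the whole line. *)
Lemma continuous_comp_cos f : {within `[-1, 1], continuous f} ->
  continuous (f \o cos).
Proof.
move=> /subspace_continuousP cf t.
have cI : cos t \in `[-1, 1] by rewrite in_itv/= cos_geN1 cos_le1.
apply: cvg_comp (cf _ cI) => U /= UU.
have := @continuous_cos R t _ UU; rewrite nbhs_simpl/=.
apply: filterS => s /=; apply.
by rewrite in_itv/= cos_geN1 cos_le1.
Qed.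

Lemma within_continuous_integrable f :
  {within `[-1, 1], continuous f} -> mu.-integrable `[-1, 1] (EFin \o f).
Proof.
move=> cf; apply: continuous_compact_integrable => //.
exact: segment_compact.
Qed.

(** The mean value theorem is applied to [H \o cos], with [H] the primitive of [f] from -1. This
    takes the place of a change of variables. *)
Lemma integral_cos_MVT f (a b : R) : {within `[-1, 1], continuous f} ->
  0 <= a -> a <= b -> b <= pi ->
  exists2 xi, xi \in `[a, b] &
    (\int[mu]_(y in `]cos b, cos a]) (f y)%:E)%E
      = (f (cos xi) * sin xi * (b - a))%:E.
Proof.
move=> cf a0 ab bpi.
have intf := within_continuous_integrable cf.
pose H y := parameterized_integral mu (-1) y f.
have cH : {within `[-1, 1], continuous H}.
  by apply: parameterized_integral_continuous => //; rewrite lerN10.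
have cosI (t : R) : cos t \in `[-1, 1] by rewrite in_itv/= cos_geN1 cos_le1.
have H'E (y : R) : y \in `]-1, 1[ -> is_derive y 1 H (f y).
  move=> yI; have /andP[y1 y2] : -1 < y < 1 by move: yI; rewrite in_itv.
  have cfy : {for y, continuous f} by exact: within_continuous_continuous cf yI.
  have [dH H'] := continuous_FTC1_closed y2 intf y1 cfy.
  apply: DeriveDef; first exact: dH.
  by rewrite -derive1E; exact: H'.
(* For [t] strictly between [a] and [b], [cos t] avoids 1 and -1, so [H] is differentiable there; at
   the ends only the continuity [cH] is required. *)
have dQ t : t \in `]a, b[ -> is_derive t 1 (H \o cos) (- (f (cos t) * sin t)).
  rewrite in_itv/= => /andP[at_ tb].
  have tI : t \in `[0, pi].
    by rewrite in_itv/= (le_trans a0 (ltW at_)) (le_trans (ltW tb)).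
  have cI : cos t \in `]-1, 1[.
    rewrite in_itv/= -cospi -[X in _ && (_ < X)]cos0.
    rewrite !ltr_cos// ?in_itv/= ?lexx ?pi_ge0//.
    by rewrite (lt_le_trans tb)//= (le_lt_trans a0).
  have h1 := H'E _ cI; have h2 := is_derive_cos t.
  by have := is_derive1_comp h1 h2; rewrite mulrN.
have [xi xiI E] :=
  MVT_segment ab dQ (continuous_subspaceT (continuous_comp_cos cH)).
exists xi => //.
have le_cos : cos b <= cos a.
  have [<-//|nab] := eqVneq a b.
  rewrite ltW// ltr_cos ?in_itv/= ?a0 ?bpi ?(le_trans a0) ?(le_trans ab)//.
  by rewrite lt_neqAle nab.
have sub : `[-1, cos a] `<=` (`[-1, 1] : set R).
  by apply: subset_itvl; rewrite bnd_simp cos_le1.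
have intfa : mu.-integrable `[-1, cos a] (EFin \o f) by exact: integrableS intf.
have := @Rintegral_itvB _ f (BLeft (-1)) (BRight (cos a)) (cos b) intfa.
rewrite !bnd_simp => /(_ (cos_geN1 _) le_cos) E2.
rewrite -[LHS]fineK; last first.
  apply: integrable_fin_num => //; apply: integrableS intfa => //.
  by apply: subset_itv; rewrite bnd_simp ?lexx// cos_geN1.
congr EFin; transitivity ((H \o cos) a - (H \o cos) b); first exact: esym E2.
by rewrite -opprB E mulNr opprK.
Qed.

End mean_value_arccos.

(** * Mass of the sublevel sets of T_k under the law of X *)

Lemma ler_cos {R : realType} :
  {in `[0, pi] &, {mono (@cos R) : x y /~ y <= x}}.
Proof. by move=> x y xI yI; rewrite !leNgt ltr_cos. Qed.

Lemma measurable_chebyshevT_le {R : realType} (k : nat) (c : R) :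
  measurable [set y : R | chebyshevT k y <= c].
Proof.
have := @measurable_chebyshevT R k measurableT `]-oo, c]%classic.
rewrite setTI => /(_ (measurable_itv _)).
by congr measurable; apply/seteqP; split => y /=; rewrite in_itv.
Qed.

Lemma chebyshevT_le1 {R : realType} (k : nat) (y : R) :
  y \in `[-1, 1] -> chebyshevT k y <= 1.
Proof. by move=> yI; rewrite chebyshevT_acos// cos_le1. Qed.

Lemma chebyshevT_geN1 {R : realType} (k : nat) (y : R) :
  y \in `[-1, 1] -> -1 <= chebyshevT k y.
Proof. by move=> yI; rewrite chebyshevT_acos// cos_geN1. Qed.

Section chebyshev_distribution.
Context {R : realType}.
Notation mu := lebesgue_measure.
Context {d : measure_display} {Omega : measurableType d}
  {P : probability Omega R} {X : {RV P >-> R}} {f : R -> R}.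
Context (X_pdf : has_pdf_on X `[-1, 1] f).
Context (cf : {within `[-1, 1], continuous f}).
Let nu : probability R R := distribution P X.

(** The hypotheses squeeze [S] between []cos b, cos a]] and [[cos b, cos a]]. Whether [cos b]
    belongs to [S] is left open, since it depends on the arc and a point has no mass. *)
Lemma distribution_cos_MVT (S : set R) (a b : R) : measurable S ->
  S `<=` `[-1, 1] -> 0 <= a -> a <= b -> b <= pi ->
  {in `[0, pi], forall t, S (cos t) -> a <= t <= b} ->
  {in `[0, pi], forall t, a <= t < b -> S (cos t)} ->
  exists2 xi, xi \in `[a, b] & fine (nu S) = f (cos xi) * sin xi * (b - a).
Proof.
move=> mS SI a0 ab bpi Sab abS.
have [xi xiI E] := integral_cos_MVT cf a0 ab bpi.
exists xi => //.
suff -> : nu S = (\int[mu]_(y in `]cos b, cos a]) (f y)%:E)%E by rewrite E.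
have aI : a \in `[0, pi] by rewrite in_itv/= a0 (le_trans ab).
have bI : b \in `[0, pi] by rewrite in_itv/= bpi (le_trans a0).
have S_cc : S `<=` `[cos b, cos a].
  move=> y Sy; have yI : y \in `[-1, 1] by exact: SI.
  have yI' : -1 <= y <= 1 by move: yI; rewrite in_itv.
  have tI : acos y \in `[0, pi] by rewrite in_itv/= acos_ge0// acos_lepi.
  have := Sab _ tI; rewrite acosK// => /(_ Sy) /andP[at_ tb].
  by rewrite /= in_itv/= -[y]acosK// !ler_cos// tb.
have S_oc : `]cos b, cos a] `<=` S.
  move=> y /=; rewrite in_itv/= => /andP[by_ ya].
  have yI' : -1 <= y <= 1.
    by rewrite (le_trans (cos_geN1 b) (ltW by_))/= (le_trans ya)// cos_le1.
  have tI : acos y \in `[0, pi] by rewrite in_itv/= acos_ge0// acos_lepi.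
  rewrite -[y]acosK ?in_itv//; apply: abS => //.
  by rewrite -[a <= _]ler_cos// -[_ < b]ltr_cos// acosK ?in_itv// by_ andbT.
case: X_pdf => mf _ /(_ S mS) nuS; rewrite [LHS]nuS setIidl//.
have [Sb|nSb] := pselect (S (cos b)).
  rewrite integral_itv_obnd_cbnd//.
    congr (integral _ _ _); apply/seteqP; split => // y /=.
    rewrite in_itv/= => /andP[]; rewrite le_eqVlt => /predU1P[<-//|by_ ya].
    by apply: S_oc; rewrite /= in_itv/= by_.
  apply/measurable_EFinP; apply: measurable_funS mf => //.
  by apply: subset_trans SI.
congr (integral _ _ _); apply/seteqP; split => // y Sy.
have := S_cc _ Sy; rewrite /= !in_itv/= => /andP[+ ->]; rewrite le_eqVlt.
by case/predU1P => [bE|->//]; move: nSb; rewrite bE.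
Qed.

(** On one arc [cos (k s)] is monotone, so the sublevel set is one interval of angles. The point
    [xi] is located only in the whole arc, which suffices because the arcs shrink as [k] grows. *)
Lemma distribution_chebyshev_piece (k j : nat) (alpha : R) :
  (j < k)%N -> 0 <= alpha <= pi ->
  exists2 xi, xi \in `[j%:R * pi / k%:R, j.+1%:R * pi / k%:R] &
    fine (nu ([set y | chebyshevT k y <= cos alpha] `&`
              `]cos (j.+1%:R * pi / k%:R), cos (j%:R * pi / k%:R)])) =
    f (cos xi) * sin xi * ((pi - alpha) / k%:R).
Proof.
move=> jk /andP[al0 alpi].
have k0 : 0 < k%:R :> R by rewrite ltr0n (leq_trans _ jk).
have pi0 := @pi_gt0 R.
set t := j%:R * pi / k%:R; set t' := j.+1%:R * pi / k%:R.
have tt' : t' = t + pi / k%:R by rewrite /t' /t -[j.+1%:R]natr1; ring.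
have t0 : 0 <= t by rewrite /t divr_ge0// mulr_ge0// pi_ge0.
have t'pi : t' <= pi.
  by rewrite /t' ler_pdivrMr// [leRHS]mulrC ler_pM2r// ler_nat.
have pik0 : 0 < pi / k%:R :> R by exact: divr_gt0.
have tI : t \in `[0, pi] by rewrite in_itv/= t0; lra.
have t'I : t' \in `[0, pi] by rewrite in_itv/= t'pi andbT; lra.
have alk : 0 <= alpha / k%:R <= pi / k%:R.
  by rewrite divr_ge0 ?(ltW k0)//= ler_pM2r// invr_gt0.
have [alk0 alk1] := andP alk.
set S := _ `&` _.
have mS : measurable S.
  apply: measurableI; first exact: measurable_chebyshevT_le.
  exact: measurable_itv.
have SI : S `<=` `[-1, 1].
  move=> y [_] /=; rewrite !in_itv/= => /andP[y1 y2].
  by rewrite (le_trans (cos_geN1 t') (ltW y1))/= (le_trans y2)// cos_le1.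
(* Removing [j] half-turns from [k s] costs the sign [(-1) ^+ j] and brings the angle into
   [[0, pi]], where [cos] is decreasing. *)
have SE s : s \in `[0, pi] -> S (cos s) <->
    (t <= s < t') /\ (-1) ^+ j * cos (k%:R * s - j%:R * pi) <= cos alpha.
  move=> sI; rewrite /S/= in_itv/= ltr_cos// ler_cos//.
  rewrite chebyshevT_cos -{1}(subrK (j%:R * pi) (k%:R * s)).
  rewrite [X in cos (_ + X)]mulr_natl.
  rewrite (alternatingn (@cosDpi R)) mulr_natl.
  by rewrite andbC; split => [[]|[]].
have phiI s : t <= s < t' -> k%:R * s - j%:R * pi \in `[0, pi].
  move=> /andP[ts st']; rewrite in_itv/=.
  have : j%:R * pi <= k%:R * s by rewrite [leRHS]mulrC -ler_pdivrMr.
  have : k%:R * s <= j.+1%:R * pi by rewrite [leLHS]mulrC -ler_pdivlMr// ltW.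
  rewrite -[j.+1%:R]natr1; lra.
have alI : alpha \in `[0, pi] by rewrite in_itv/= al0.
have alI' : pi - alpha \in `[0, pi] by rewrite in_itv/=; lra.
have phiE s u : (k%:R * s - j%:R * pi <= u) = (s <= t + u / k%:R).
  rewrite lerBlDr -ler_pdivlMl//; congr (_ <= _); rewrite /t; ring.
have phiE' s u : (u <= k%:R * s - j%:R * pi) = (t + u / k%:R <= s).
  rewrite lerBrDr -ler_pdivrMl//; congr (_ <= _); rewrite /t; ring.
have cosE' : - cos alpha = cos (pi - alpha) by rewrite addrC cosDpi cosN.
(* With phi = k s - j pi in [0, pi[, T_k (cos s) = (-1)^j cos phi; the condition
   reads phi <= pi - alpha for odd j and alpha <= phi for even j. *)
have [jodd|jeven] := boolP (odd j).
- have [|||||s sI|s sI|xi xiI E] := @distribution_cos_MVT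
      S t (t + (pi - alpha) / k%:R) => //.
  + rewrite mulrBl; lra.
  + rewrite mulrBl; lra.
  + move/(SE _ sI) => [/[dup] /phiI pI /andP[-> st']].
    rewrite -signr_odd jodd expr1 mulN1r lerNl cosE'.
    by rewrite ler_cos// phiE.
  + move=> /andP[ts st]; apply/(SE _ sI).
    have st' : t <= s < t' by rewrite ts/=; move: st; rewrite mulrBl; lra.
    split => //; rewrite -signr_odd jodd expr1 mulN1r lerNl cosE'.
    by rewrite ler_cos ?phiI// phiE ltW.
  + exists xi; last by rewrite E; congr (_ * _); ring.
    move: xiI; rewrite !in_itv/= mulrBl; lra.
- have [|||||s sI|s sI|xi xiI E] := @distribution_cos_MVT
      S (t + alpha / k%:R) t' => //.
  + lra.
  + lra.
  + move/(SE _ sI) => [/[dup] /phiI pI /andP[ts st']].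
    rewrite -signr_odd (negbTE jeven) expr0 mul1r.
    by rewrite ler_cos// phiE' => ->/=; exact: ltW.
  + move=> /andP[ts st]; apply/(SE _ sI).
    have st' : t <= s < t' by rewrite st; lra.
    split => //; rewrite -signr_odd (negbTE jeven) expr0 mul1r.
    by rewrite ler_cos ?phiI// phiE'.
  + exists xi; last by rewrite E; congr (_ * _); rewrite tt'; ring.
    move: xiI; rewrite !in_itv/=; lra.
Qed.


Let m (A : set R) : R := fine (nu A).

Let mU (A B : set R) : measurable A -> measurable B -> A `&` B = set0 ->
  m (A `|` B) = m A + m B.
Proof.
move=> mA mB AB; rewrite /m measureU// fineD//; exact: fin_num_measure.
Qed.

(** Induction on the number [n] of arcs counted from the angle 0: each new arc adds an error of at
    most [e * (pi / k)]. *)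
Lemma distribution_chebyshev_le (k n : nat) (alpha e r : R) :
  {in `[0, pi], forall s t, `|s - t| < r ->
    `|f (cos s) * sin s - f (cos t) * sin t| < e} ->
  pi / k%:R < r -> (n <= k)%N -> 0 <= alpha <= pi ->
  `|m ([set y | chebyshevT k y <= cos alpha] `&` `]cos (n%:R * pi / k%:R), 1])
    - (pi - alpha) / pi * m `]cos (n%:R * pi / k%:R), 1]|
    <= n%:R * e * (pi / k%:R).
Proof.
move=> He kr + al; elim: n => [_|j IH jk].
  rewrite mulr0n !mul0r cos0 set_itv_ge; last by rewrite bnd_simp ltxx.
  by rewrite setI0 /m measure0/= mulr0 subrr normr0.
have {IH} := IH (ltnW jk).
set t := j%:R * pi / k%:R; set t' := j.+1%:R * pi / k%:R.
set I := `]cos t, 1]%classic; set J := `]cos t', cos t]%classic.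
set S := [set y | _] => IH.
have k0 : 0 < k%:R :> R by rewrite ltr0n (leq_trans _ jk).
have pi0 := @pi_gt0 R.
have pik0 : 0 < pi / k%:R :> R by exact: divr_gt0.
have tt' : t' = t + pi / k%:R by rewrite /t' /t -[j.+1%:R]natr1; ring.
have t0 : 0 <= t by rewrite /t divr_ge0// mulr_ge0// pi_ge0.
have t'pi : t' <= pi.
  by rewrite /t' ler_pdivrMr// [leRHS]mulrC ler_pM2r// ler_nat.
have IJ : `]cos t', 1]%classic = I `|` J.
  have ct : cos t' <= cos t.
    by rewrite ler_cos ?in_itv/= ?t'pi ?t0 /= ?andbT; lra.
  rewrite setUC /I /J -itv_bndbnd_setU// bnd_simp ?cos_le1//.
have dIJ : I `&` J = set0.
  apply/seteqP; split => // y []; rewrite /I /J /= !in_itv/=.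
  move=> /andP[y1 _] /andP[_ y2].
  by have := lt_le_trans y1 y2; rewrite ltxx.
have mS : measurable S by exact: measurable_chebyshevT_le.
have mI : measurable I by exact: measurable_itv.
have mJ : measurable J by exact: measurable_itv.
rewrite IJ setIUr (mU _ _ dIJ)// mU;
  [|exact: measurableI|exact: measurableI|]; last first.
  by rewrite setIACA dIJ setI0.
have [xi xiI xiE] := distribution_chebyshev_piece jk al.
(* Taking [alpha = 0] gives the mass of the whole arc, because [T_k <= 1 = cos 0] on [[-1, 1]]. *)
have [|eta etaI etaE] := @distribution_chebyshev_piece k j 0 jk.
  by rewrite lexx pi_ge0.
rewrite -/t -/t' -/J -/S -/(m _) in xiI xiE etaI etaE.
have {}etaE : m J = f (cos eta) * sin eta * (pi / k%:R).
  rewrite -[pi in RHS]subr0 -etaE; congr m; rewrite setIidr// => y.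
  rewrite /J/= in_itv/= cos0 => /andP[y1 y2]; apply: chebyshevT_le1.
  by rewrite in_itv/= (le_trans (cos_geN1 _) (ltW y1)) (le_trans y2)// cos_le1.
(* Both points lie in the same arc, whose length [pi / k] is less than [r]. *)
have g_close : `|f (cos xi) * sin xi - f (cos eta) * sin eta| < e.
  move: xiI etaI; rewrite !in_itv/= => /andP[x1 x2] /andP[y1 y2].
  apply: He; first by rewrite in_itv/= (le_trans t0)//= (le_trans x2).
  by apply: le_lt_trans kr; rewrite ler_norml; apply/andP; split; lra.
rewrite mulrDr opprD addrACA (le_trans (ler_normD _ _))//.
have -> : j.+1%:R * e * (pi / k%:R) = j%:R * e * (pi / k%:R) + e * (pi / k%:R).
  by rewrite -[j.+1%:R]natr1; ring.
rewrite lerD//.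
rewrite xiE etaE.
have -> : f (cos xi) * sin xi * ((pi - alpha) / k%:R) -
  (pi - alpha) / pi * (f (cos eta) * sin eta * (pi / k%:R)) =
  (f (cos xi) * sin xi - f (cos eta) * sin eta) * ((pi - alpha) / k%:R).
  move: (gt_eqF pi0) (gt_eqF k0); generalize (pi : R) => p p0 k1.
  by field; rewrite p0 k1.
have /andP[al0 alpi] := al.
rewrite normrM ler_pM//; first exact: ltW.
rewrite ger0_norm; last by rewrite divr_ge0 ?subr_ge0// ltW.
by rewrite ler_pM2r ?invr_gt0// gerBl.
Qed.

Lemma cvg_distribution_chebyshev (alpha : R) : 0 <= alpha <= pi ->
  nu [set y | chebyshevT n y <= cos alpha] @[n --> \oo] -->
    ((pi - alpha) / pi)%:E.
Proof.
move=> al; set c := (pi - alpha) / pi.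
have mE (A : set R) : measurable A -> nu A = (m A)%:E.
  by move=> mA; rewrite /m fineK// fin_num_measure.
under eq_fun do rewrite (mE _ (measurable_chebyshevT_le _ _)).
apply: cvg_EFin; first by near=> n.
apply/cvgrPdist_le => e e0.
have pi0 := @pi_gt0 R.
pose g t := f (cos t) * sin t.
have cg : continuous g.
  move=> t; apply: cvgM; first exact: continuous_comp_cos.
  exact: continuous_sin.
(* The tolerance [e / pi] makes the total error of the [k] arcs equal to [e]. *)
have [r r0 Hr] :=
  @continuous_segment_uniform R g 0 pi (e / pi) cg (divr_gt0 e0 pi0).
near=> k.
have k0 : 0 < k%:R :> R by rewrite ltr0n; near: k; exact: nbhs_infty_gt.
have kr : pi / k%:R < r.
  rewrite ltr_pdivrMr// mulrC -ltr_pdivrMr//; near: k; exact: nbhs_infty_gtr.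
(* With [n = k] the arcs fill [[0, pi[], so the interval becomes []-1, 1]]. *)
have := distribution_chebyshev_le Hr kr (leqnn k) al.
rewrite mulrAC divff ?gt_eqF// mul1r cospi /=.
have -> : k%:R * (e / pi) * (pi / k%:R) = e.
  move: (gt_eqF pi0) (gt_eqF k0); generalize (pi : R) => p p0 k1.
  by field; rewrite p0 k1.
(* Within [[-1, 1]] the only point left out is -1, and the law has a density. *)
have m1 (A : set R) : measurable A -> m (A `&` `]-1, 1]) = m A.
  move=> mA; rewrite /m [in RHS](measureDI nu mA (measurable_itv `]-1, 1])).
  rewrite [X in (X + _)%E](_ : _ = 0%E) ?add0e//.
  case: X_pdf => _ _ fE; rewrite [LHS]fE; last exact: measurableD.
  apply: (@integral_Sset1 _ _ _ (-1)) => y /= [[_]]; rewrite !in_itv/=.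
  move=> /negP; rewrite negb_and -leNgt -ltNge.
  move=> /orP[y1 /andP[y2 _]|y1 /andP[_]].
    by apply/eqP; rewrite eq_le y1.
  by move/(lt_le_trans y1); rewrite ltxx.
rewrite m1; last exact: measurable_chebyshevT_le.
have -> : m `]-1, 1]%classic = 1.
  rewrite -[X in m X]setTI m1// /m.
  have -> : nu setT = 1%E by exact: probability_setT.
  by [].
by rewrite mulr1 distrC.
Unshelve. all: by end_near. Qed.

End chebyshev_distribution.

(** * Pointwise convergence of the distribution functions *)

Theorem theorem3p1 (R : realType) (d : measure_display)
    (Omega : measurableType d) (P : probability Omega R) (X : {RV P >-> R})
    (fX : R -> R) (mu : nat -> R)
    (X_range : forall w : Omega, X w \in `[-1, 1])
    (X_pdf : has_pdf_on X `[-1, 1] fX)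
    (fX_cont : {within `[-1, 1], continuous fX})
    (abs_cvg : forall x : R, x \in `[-1, 1] ->
       cvgn (series (fun l : nat => `|mu l * chebyshevT l x|)))
    (expansion : forall x : R, x \in `[-1, 1] ->
       series (fun l : nat => mu l * chebyshevT l x) @ \oo --> fX x) :
  exists (d' : measure_display) (Omega' : measurableType d')
    (P' : probability Omega' R) (Gamma : {RV P' >-> R}),
    [/\ forall w : Omega', Gamma w \in `]-1, 1[,
        has_pdf_on Gamma `]-1, 1[ (fun z : R => pi^-1 * (Num.sqrt (1 - z ^+ 2))^-1) &
        cvg_in_distribution
          (fun k : nat => (chebyshevT k \o X)%FUN : {RV P >-> R}) Gamma].
Proof.
exists _, (measurableTypeR R), (arcsine_prob : probability _ R),
  (arcsine_var : {RV arcsine_prob >-> R}).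
split.
- exact: arcsine_var_itv.
- split; first exact: measurable_arcsine_pdf.
    by move=> x _; exact: arcsine_pdf_ge0.
  by move=> A mA; rewrite distribution_arcsine_var.
move=> x _.
have -> : cdf (arcsine_var : {RV arcsine_prob >-> R}) x =
    arcsine_prob `]-oo, x].
  exact: distribution_arcsine_var.
have cdfE n : cdf ((chebyshevT n \o X)%FUN : {RV P >-> R}) x =
    distribution P X [set y | chebyshevT n y <= x].
  by congr (P _); apply/seteqP; split => w /=; rewrite in_itv.
under eq_fun do rewrite cdfE.
(* Outside [[-1, 1]] the distribution functions of all [T_n (X)] and of the limit agree: they are 0
   on the left and 1 on the right. *)
have [xN1|xgeN1] := ltP x (-1).
  have -> : arcsine_prob (`]-oo, x] : set R) = 0%E.
    rewrite arcsine_prob_setI (_ : _ `&` _ = set0) ?measure0//.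
    apply/seteqP; split => // y []/=; rewrite !in_itv/= => yx /andP[y1 _].
    by have := lt_trans (le_lt_trans yx xN1) y1; rewrite ltxx.
  apply: cvg_near_cst; near=> n.
  rewrite /distribution /pushforward (_ : _ @^-1` _ = set0) ?measure0//.
  apply/seteqP; split => // w /= Tx.
  have := le_lt_trans (le_trans (chebyshevT_geN1 n (X_range w)) Tx) xN1.
  by rewrite ltxx.
have [x1|xle1] := ltP 1 x.
  have -> : arcsine_prob (`]-oo, x] : set R) = 1%E.
    rewrite -(probability_setT arcsine_prob) arcsine_prob_setI.
    rewrite [RHS]arcsine_prob_setI; congr arcsine_prob.
    apply/seteqP; split => y []/=; rewrite !in_itv/= => yx /andP[-> y1];
      split => //.
    by rewrite ltW// (lt_trans y1).
  apply: cvg_near_cst; near=> n.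
  rewrite -(probability_setT P); congr (P _); apply/seteqP; split => // w _ /=.
  by rewrite (le_trans (chebyshevT_le1 n (X_range w)))// ltW.
rewrite arcsine_prob_ray ?xgeN1//.
(* For [x] in [[-1, 1]], write [x = cos alpha] with [alpha = acos x]. *)
have := cvg_distribution_chebyshev X_pdf fX_cont (alpha := acos x).
by rewrite acosK ?in_itv/= ?xgeN1// acos_ge0 ?acos_lepi ?xgeN1//; apply.
Unshelve. all: by end_near. Qed.
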